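(* Let $n\in\mathbb N_0$, let $q\in\mathbb C$ with $q\ne0$, $|q|\ne1$, and let $\alpha,\beta\in\mathbb C$, such that no denominator below vanishes. Then, with the upper signs taken throughout or the lower signs taken throughout, $$P_n^{(\alpha,\beta)}\left(\pm\tfrac12(q^{\frac34}+q^{-\frac34})|q\right)=\left(\pm q^{\frac\alpha2}\right)^n\frac{(\pm q^{\frac{\alpha+1}{2}},\mp q^{\frac{\beta+1}{2}};q^{\frac12})_n}{(q^{\frac12},-q^{\frac{\alpha+\beta+1}{2}};q^{\frac12})_n}\left(1-\frac{(1-q^{\frac12})(1-q^{-\frac n2})(1-q^{\frac{\alpha+\beta+n+1}{2}})}{(1\mp q^{\frac{\alpha+1}{2}})(1\pm q^{\frac{\beta+1}{2}})}\right).$$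
   Context: Complex powers of $q$: fix a logarithm $\log q$ and set $q^s:=\exp(s\log q)$. Notation: $(a;q)_n:=\prod_{k=0}^{n-1}(1-aq^k)$, and $(a_1,\dots,a_r;q)_n:=\prod_i (a_i;q)_n$; in the statement $\pm a$ denotes a single entry whose sign is the chosen one. Askey--Wilson polynomials: for $x=\frac12(z+z^{-1})$, $z\in\mathbb C\setminus\{0\}$, $$p_n(x;a,b,c,d|q):=a^{-n}(ab,ac,ad;q)_n\sum_{k=0}^n\frac{(q^{-n},q^{n-1}abcd,az,az^{-1};q)_k}{(q,ab,ac,ad;q)_k}q^k,$$ where $(ab;q)_n/(ab;q)_k$ is read as $(abq^k;q)_{n-k}$ (likewise for $ac$, $ad$), so that $p_n$ is always defined. Continuous $q$-Jacobi polynomials: $$P_n^{(\alpha,\beta)}(x|q):=\frac{q^{(\frac{\alpha}{2}+\frac14)n}}{(q,-q^{\frac{\alpha+\beta+1}{2}},-q^{\frac{\alpha+\beta+2}{2}};q)_n}\,p_n\left(x;q^{\frac{\alpha}{2}+\frac14},q^{\frac{\alpha}{2}+\frac34},-q^{\frac{\beta}{2}+\frac14},-q^{\frac{\beta}{2}+\frac34}\big|q\right).$$ *)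

(* Defs.v *)
From mathcomp Require Import all_boot all_order all_algebra.
From mathcomp Require Import ring.
From mathcomp Require Import complex.
From mathcomp Require Import reals sequences exp trigo.

Set Implicit Arguments.
Unset Strict Implicit.
Unset Printing Implicit Defensive.

Import Order.TTheory GRing.Theory Num.Theory.
Local Open Scope ring_scope.
Local Open Scope complex_scope.

Definition qpoch (F : fieldType) (a q : F) (n : nat) : F :=
  \prod_(k < n) (1 - a * q ^+ k).

Definition qpochs (F : fieldType) (s : seq F) (q : F) (n : nat) : F :=
  \prod_(a <- s) qpoch a q n.

(* The Askey-Wilson sum in terms of z, with (ab; q)_n / (ab; q)_k read as
   (ab q^k; q)_(n-k), and likewise for ac and ad. *)
Definition askey_wilson_z (F : fieldType) (n : nat) (z a b c d q : F) : F :=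
  a ^- n *
  \sum_(k < n.+1)
    qpochs [:: q ^- n; q ^ (n%:Z - 1) * (a * b * c * d); a * z; a * z^-1] q k
    / qpoch q q k
    * qpochs [:: a * b * q ^+ k; a * c * q ^+ k; a * d * q ^+ k] q (n - k)
    * q ^+ k.

(* A solution z of x = (z + z^-1) / 2; the other one is its inverse. *)
Definition zof (C : numClosedFieldType) (x : C) : C := x + sqrtC (x ^+ 2 - 1).

Definition askey_wilson (C : numClosedFieldType) (n : nat) (x a b c d q : C) :
    C :=
  askey_wilson_z n (zof x) a b c d q.

(* The value does not depend on which z represents x. *)
Lemma askey_wilsonE (C : numClosedFieldType) (n : nat) (z a b c d q : C) :
  z != 0 ->
  askey_wilson n (2^-1 * (z + z^-1)) a b c d q = askey_wilson_z n z a b c d q.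
Proof.
move=> z0; rewrite /askey_wilson /zof.
set x := 2^-1 * _; set r := sqrtC _.
have rr : r ^+ 2 = x ^+ 2 - 1 by rewrite /r sqrtCK.
have : (x + r - z) * (x + r - z^-1) = 0.
  have -> : (x + r - z) * (x + r - z^-1)
          = x ^+ 2 + r ^+ 2 + 2 * x * r - (x + r) * (z + z^-1) + 1 by field.
  have -> : z + z^-1 = 2 * x by rewrite /x; field.
  by rewrite rr; ring.
move=> /eqP; rewrite mulf_eq0 !subr_eq0 => /orP[] /eqP -> //.
congr (_ * _); apply: eq_bigr => k _; congr (_ / _ * _ * _).
by rewrite /qpochs !big_cons invrK [X in _ * (_ * X)]mulrCA.
Qed.

Definition cexp (R : realType) (z : R[i]) : R[i] :=
  (expR (complex.Re z))%:C * (cos (complex.Im z) +i* sin (complex.Im z)).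

(* q^s, where q = cexp logq. *)
Definition qpow (R : realType) (logq s : R[i]) : R[i] := cexp (s * logq).

Definition qJacobi_den (R : realType) (n : nat) (alpha beta logq : R[i]) :
    R[i] :=
  let q := cexp logq in
  qpochs [:: q; - qpow logq ((alpha + beta + 1) / 2);
               - qpow logq ((alpha + beta + 2) / 2)] q n.

(* The continuous q-Jacobi polynomial P_n^(alpha,beta)(x|q) for q = cexp logq. *)
Definition qJacobi (R : realType) (n : nat) (alpha beta x logq : R[i]) : R[i] :=
  let q := cexp logq in
  qpow logq ((alpha / 2 + 1 / 4) * n%:R) / qJacobi_den n alpha beta logq
  * askey_wilson n x
      (qpow logq (alpha / 2 + 1 / 4)) (qpow logq (alpha / 2 + 3 / 4))
      (- qpow logq (beta / 2 + 1 / 4)) (- qpow logq (beta / 2 + 3 / 4)) q.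

(* Main.v *)
Require Import Defs.
From mathcomp Require Import all_boot all_order all_algebra.
From mathcomp Require Import ring.
From mathcomp Require Import complex.
From mathcomp Require Import reals sequences exp trigo.

Set Implicit Arguments.
Unset Strict Implicit.
Unset Printing Implicit Defensive.

Import Order.TTheory GRing.Theory Num.Theory.
Local Open Scope ring_scope.
Local Open Scope complex_scope.

(* With h = q^(1/2), A = eps q^(alpha/2), B = eps q^(beta/2), C = A B, the
   point of the theorem becomes z = h^(3/2) and the sign disappears.  The
   divided-difference operator, which compares p_n at h z and z / h and yields
   the p_(n-1) with parameters multiplied by h, reduces z = h^(3/2) to the value
   at z = h^(1/2), which is a product.  The latter is obtained by creative
   telescoping: for M = q^(n+1), the sums T_n(C) at z = h^(1/2) satisfy
     C T_(n+1)(C) = (1 + C M / h) (1 + C M) (M C^2 - A^2) T_n(C)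
                    + (1 - C^2 M^2) (C + A) (C h + A) T_n(C h),
   and the leading coefficient C never vanishes, so that induction on n, for
   all C at once, needs no genericity of the parameters. *)

(** * Finite q-Pochhammer products over a field *)

Section QPochhammer.
Variable F : fieldType.
Implicit Types (a q h : F) (m n : nat).

Lemma qpoch0 a q : qpoch a q 0 = 1.
Proof. by rewrite /qpoch big_ord0. Qed.

Lemma qpochS a q n : qpoch a q n.+1 = qpoch a q n * (1 - a * q ^+ n).
Proof. by rewrite /qpoch big_ord_recr. Qed.

Lemma qpochSl a q n : qpoch a q n.+1 = (1 - a) * qpoch (a * q) q n.
Proof.
rewrite /qpoch big_ord_recl expr0 mulr1; congr (_ * _).
by apply: eq_bigr => i _; rewrite /= exprS mulrA.
Qed.

Lemma qpoch_shift a q n :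
  qpoch a q n * (1 - a * q ^+ n) = (1 - a) * qpoch (a * q) q n.
Proof. by rewrite -qpochS qpochSl. Qed.

Lemma qpoch_neq0_le a q m n :
  (m <= n)%N -> qpoch a q n != 0 -> qpoch a q m != 0.
Proof.
move=> /subnK <-; elim: (n - m)%N => // l IHl.
by rewrite addSn qpochS mulf_eq0 negb_or => /andP[/IHl].
Qed.

(** Even and odd exponents of h separate. Together with [qpoch_sqr], this converts the base-q
    denominators to base h. *)
Lemma qpoch_double a h n :
  qpoch a h n.*2 = qpoch a (h ^+ 2) n * qpoch (a * h) (h ^+ 2) n.
Proof.
elim: n => [|n IHn]; first by rewrite !qpoch0 mulr1.
by rewrite doubleS !qpochS IHn -exprM mul2n [h ^+ n.*2.+1]exprS; ring.
Qed.

Lemma qpoch_sqr a h n :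
  qpoch (a ^+ 2) (h ^+ 2) n = qpoch a h n * qpoch (- a) h n.
Proof.
elim: n => [|n IHn]; first by rewrite !qpoch0 mulr1.
by rewrite !qpochS IHn exprAC; ring.
Qed.

Lemma qpochs_cons a (s : seq F) q n :
  qpochs (a :: s) q n = qpoch a q n * qpochs s q n.
Proof. by rewrite /qpochs big_cons. Qed.

Lemma qpochs1 a q n : qpochs [:: a] q n = qpoch a q n.
Proof. by rewrite /qpochs big_seq1. Qed.

Definition qpochsE := (qpochs1, qpochs_cons).

End QPochhammer.

(** * The Askey-Wilson sum in base q = h^2: recurrence, product value, shift *)

Section QuarticSum.
Variables (F : fieldType) (h : F).
Hypothesis h_neq0 : h != 0.
Let q := h ^+ 2.

(* With a = A h^(1/2), b = A h^(3/2), c = - B h^(1/2), d = - B h^(3/2) and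
   C = A B, the k-th term of the Askey-Wilson sum, where u = a z, v = a / z. *)
Definition awJ_term n (A C u v : F) k : F :=
  qpochs [:: q ^- n; q ^+ n.+1 * C ^+ 2; u; v] q k / qpoch q q k
  * qpochs [:: A ^+ 2 * q ^+ k.+1; - (C * h * q ^+ k); - (C * q ^+ k.+1)] q
           (n - k)
  * q ^+ k.

Definition awJ_sum n (A C u v : F) : F := \sum_(k < n.+1) awJ_term n A C u v k.

(* Found by Gosper summation: the partial sums of awJ_defect, the term-wise
   defect in the recurrence awJ_sum_rec. *)
Definition awJ_cert n (A C : F) k : F :=
  C * (1 - C * q ^+ n.+1)
  * (qpochs [:: q ^- n; q ^+ n.+2 * C ^+ 2] q k / qpoch q q k
     * qpochs [:: A * h; A] q k.+1
     * qpochs [:: A ^+ 2 * q ^+ k.+1; - (C * h * q ^+ k.+1)] q (n - k)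
     * qpoch (- (C * q ^+ k.+1)) q (n - k).+1).

Definition awJ_defect n (A C : F) k : F :=
  C * awJ_term n.+1 A C (A * h) A k
  - (1 + C * q ^+ n * h) * (1 + C * q ^+ n.+1)
    * (q ^+ n.+1 * C ^+ 2 - A ^+ 2) * awJ_term n A C (A * h) A k
  - (1 - C ^+ 2 * q ^+ n.+1 ^+ 2) * (C + A) * (C * h + A)
    * awJ_term n A (C * h) (A * h) A k.

Let q_neq0 : q != 0. Proof. exact: expf_neq0. Qed.

(** The factor of index n is 1 - q^-n q^n; it kills the term k = n+1 of a degree-n sum. *)
Lemma qpoch_qneg n : qpoch (q ^- n) q n.+1 = 0.
Proof. by rewrite qpochS mulVf ?subrr ?mulr0 // expf_neq0 // q_neq0. Qed.

Lemma qpoch_qneg_shift n k :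
  qpoch (q ^- n.+1) q k.+1 = (1 - q ^- n.+1) * qpoch (q ^- n) q k.
Proof.
rewrite qpochSl; congr (_ * qpoch _ _ _).
by rewrite exprS invfM mulrC mulrA mulfV ?mul1r // q_neq0.
Qed.

Lemma awJ_defect0 n A C : awJ_defect n A C 0 = awJ_cert n A C 0.
Proof.
rewrite /awJ_defect /awJ_term /awJ_cert !qpochsE !qpoch0 !subn0.
rewrite ?expr0 !expr1 ?mulr1 !invr1 ?mulr1 ?mul1r.
have -> : - (C * h * h) = - (C * q) by rewrite /q; ring.
have -> : - (C * h * q) = - (C * h) * q by rewrite mulNr.
rewrite !qpochS !qpoch0 !mul1r.
have := qpoch_shift (- (C * h)) q n.
set X := qpoch (- (C * h) * q) q n; set Y := qpoch (- (C * h)) q n.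
set U := qpoch (A ^+ 2 * q) q n; set V := qpoch (- (C * q)) q n => e.
have e' : Y * (1 + C * h * q ^+ n) = (1 + C * h) * X.
  by move: e; rewrite !mulNr !opprK.
(* [X] comes from the term with [C * h]; this grouping lets [e'] make every summand a multiple of
   [X]. *)
transitivity (U * V * (1 + C * q ^+ n.+1) *
  (C * (1 - A ^+ 2 * q ^+ n.+1) * (Y * (1 + C * h * q ^+ n))
  - (q ^+ n.+1 * C ^+ 2 - A ^+ 2) * (Y * (1 + C * h * q ^+ n))
  - (1 - C * q ^+ n.+1) * (C + A) * (C * h + A) * X)).
  by rewrite ![q ^+ n.+1]exprS; ring.
by rewrite e' ![q ^+ n.+1]exprS /q; ring.
Qed.

Lemma awJ_defectS n A C j : (j < n)%N -> qpoch q q j.+1 != 0 ->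
  awJ_defect n A C j.+1 = awJ_cert n A C j.+1 - awJ_cert n A C j.
Proof.
(* Writing n as m + j + 1 removes truncated subtraction and splits q^n as q^m q^(j+1). *)
move=> jn; have [m nE] : exists m, n = (m + j.+1)%N.
  by exists (n - j.+1)%N; rewrite subnK.
have n1k : (n.+1 - j.+1 = m.+1)%N by rewrite nE -addSn addnK.
have nk : (n - j.+1 = m)%N by rewrite nE addnK.
have nj : (n - j = m.+1)%N by rewrite nE addnS -addSn addnK.
rewrite qpochS mulf_eq0 negb_or -exprS => /andP[P0 q0].
rewrite /awJ_defect /awJ_term /awJ_cert !qpochsE n1k nk nj qpoch_qneg_shift.
have -> : q ^+ n.+1 * (C * h) ^+ 2 = q ^+ n.+2 * C ^+ 2.
  by rewrite [q ^+ n.+2]exprS /q; ring.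
have -> : - (C * h * h * q ^+ j.+1) = - (C * q ^+ j.+2).
  by rewrite [q ^+ j.+2]exprS /q; ring.
have cE : - (C * q ^+ j.+2) = - (C * q ^+ j.+1) * q.
  by rewrite [q ^+ j.+2]exprSr; ring.
have chE : - (C * h * q ^+ j.+2) = - (C * h * q ^+ j.+1) * q.
  by rewrite [q ^+ j.+2]exprSr; ring.
rewrite ![qpoch (q ^- n) q j.+1]qpochS.
rewrite [qpoch (q ^+ n.+1 * C ^+ 2) q j.+1]qpochSl.
have -> : q ^+ n.+1 * C ^+ 2 * q = q ^+ n.+2 * C ^+ 2.
  by rewrite [q ^+ n.+2]exprSr; ring.
rewrite ![qpoch (q ^+ n.+2 * C ^+ 2) q j.+1]qpochS.
rewrite ![qpoch q q j.+1]qpochS.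
rewrite ![qpoch A q j.+2]qpochS ![qpoch (A * h) q j.+2]qpochS.
rewrite [qpoch (A ^+ 2 * q ^+ j.+1) q m.+1]qpochSl.
have -> : A ^+ 2 * q ^+ j.+1 * q = A ^+ 2 * q ^+ j.+2.
  by rewrite [q ^+ j.+2]exprSr; ring.
rewrite ![qpoch (A ^+ 2 * q ^+ j.+2) q m.+1]qpochS.
rewrite [qpoch (- (C * q ^+ j.+1)) q m.+2]qpochSl -cE.
rewrite ![qpoch (- (C * q ^+ j.+2)) q m.+1]qpochS.
have := qpoch_shift (- (C * h * q ^+ j.+1)) q m.
rewrite [qpoch (- (C * h * q ^+ j.+1)) q m.+1]qpochS -chE.
move: P0 q0.
set W := qpoch (- (C * h * q ^+ j.+1)) q m.
set W' := qpoch (- (C * h * q ^+ j.+2)) q m.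
move: W W' => W W'.
move: (qpoch (- (C * q ^+ j.+2)) q m) => Z.
move: (qpoch (A ^+ 2 * q ^+ j.+2) q m) (qpoch q q j) => Y P.
rewrite ![q ^+ n.+2]exprS ![q ^+ n.+1]exprS ![q ^+ j.+2]exprS ![q ^+ j.+1]exprS.
have -> : q ^+ n = q ^+ m * (q * q ^+ j) by rewrite nE exprD exprS.
have := expf_neq0 j q_neq0; have := expf_neq0 m q_neq0.
move: (q ^+ m) (q ^+ j) => Q K Q0 K0.
move: (qpoch _ q j) (qpoch _ q j) => X1 X2.
move: (qpoch _ q j.+1) (qpoch _ q j.+1) => X3 X4.
move=> P0 q0 e; apply/eqP; rewrite -subr_eq0; apply/eqP.
set lhs := W * _ in e; set rhs := _ * W' in e.
set M := Q * (q * K) * q.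
(* Here [M] is q^(n+1). The two sides differ by a multiple of the relation [e] between (-C h
   q^(j+1); q)_m and its shift. *)
transitivity (X1 * X2 * X3 * X4 * Y * Z * (1 + C * M) / P
   * ((C * (1 - M^-1) * (1 - M * q * C ^+ 2 * K) * (1 - A ^+ 2 * M)
       - (M * C ^+ 2 - A ^+ 2) * (1 - q / M * K) * (1 - M * C ^+ 2))
       / (1 - q * K) * (q * K)
      + C * (1 - C * M) * (1 - A ^+ 2 * (q * K)) * (1 + C * (q * K)))
   * (lhs - rhs)); last by rewrite e subrr mulr0.
rewrite /lhs /rhs /M /q; field.
by apply/and5P; split.
Qed.

(** Both degree-n terms vanish at k = n+1, so the top term of degree n+1 alone cancels the
    certificate. *)
Lemma awJ_defect_last n A C : qpoch q q n.+1 != 0 ->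
  awJ_defect n A C n.+1 = - awJ_cert n A C n.
Proof.
move=> qn0; have Pn0 := qpoch_neq0_le (leqnSn n) qn0.
rewrite /awJ_defect /awJ_term /awJ_cert !qpochsE subnn (subnS n) subnn.
rewrite !qpoch0 ?mulr1.
rewrite qpoch_qneg qpoch_qneg_shift !mul0r !mulr0 !subr0.
move: qn0; rewrite [qpoch q q n.+1]qpochS mulf_eq0 negb_or => /andP[_].
rewrite ![qpoch (q ^+ n.+2 * C ^+ 2) q n.+1]qpochS !qpochS !qpoch0.
rewrite ![q ^+ n.+2]exprS ![q ^+ n.+1]exprS.
have := expf_neq0 n q_neq0.
move: (q ^+ n) (qpoch q q n) Pn0 => Q P Pn0 Q0 q0.
move: (qpoch _ q n) (qpoch _ q n) (qpoch _ q n) (qpoch _ q n) => X1 X2 X3 X4.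
rewrite /q; field.
by rewrite q0 h_neq0 Pn0 Q0.
Qed.

Lemma sum_awJ_defect n A C : qpoch q q n.+1 != 0 ->
  \sum_(k < n.+2) awJ_defect n A C k = 0.
Proof.
move=> qn0; have Pn0 := qpoch_neq0_le (leqnSn n) qn0.
suff H m : (m <= n)%N -> \sum_(k < m.+1) awJ_defect n A C k = awJ_cert n A C m.
  by rewrite big_ord_recr /= H // awJ_defect_last // addrN.
elim: m => [|m IHm] mn; first by rewrite big_ord1 awJ_defect0.
rewrite big_ord_recr /= IHm ?(ltnW mn) // awJ_defectS // 1?addrC ?subrK //.
exact: qpoch_neq0_le (leqW mn) qn0.
Qed.

Lemma awJ_sum_rec n A C : qpoch q q n.+1 != 0 ->
  C * awJ_sum n.+1 A C (A * h) A =
    (1 + C * q ^+ n * h) * (1 + C * q ^+ n.+1)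
    * (q ^+ n.+1 * C ^+ 2 - A ^+ 2) * awJ_sum n A C (A * h) A
  + (1 - C ^+ 2 * q ^+ n.+1 ^+ 2) * (C + A) * (C * h + A)
    * awJ_sum n A (C * h) (A * h) A.
Proof.
move=> qn0; have := sum_awJ_defect A C qn0.
(* A zero term at k = n+1 gives all three sums the same range. *)
have ext D u v : awJ_sum n A D u v = \sum_(k < n.+2) awJ_term n A D u v k.
  by rewrite [RHS]big_ord_recr /= {2}/awJ_term !qpochsE qpoch_qneg !mul0r addr0.
rewrite /awJ_defect !sumrB -!mulr_sumr -!ext => /eqP.
by rewrite subr_eq add0r subr_eq addrC => /eqP.
Qed.

(* The value at z = h^(1/2). *)
Lemma awJ_sum_product n A C : C != 0 -> qpoch q q n != 0 ->
  qpoch (- (C * h)) h n * awJ_sum n A C (A * h) A =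
  qpoch (A * h) h n * \prod_(j < n) (A + C * h ^+ j.+1) * qpoch (- h) h n
  * qpoch (- (C * h)) h n.*2.
Proof.
elim: n C => [|n IHn] C C0 qn0.
  rewrite /awJ_sum big_ord1 /awJ_term !qpochsE !qpoch0 big_ord0 expr0.
  by rewrite invr1 !mulr1.
have Pn0 := qpoch_neq0_le (leqnSn n) qn0.
have e1 := IHn _ C0 Pn0.
have e2 := IHn _ (mulf_neq0 C0 h_neq0) Pn0.
apply: (mulfI C0); rewrite mulrCA awJ_sum_rec //.
have sh m : qpoch (- (C * h)) h m * (1 + C * h ^+ m.+1)
    = (1 + C * h) * qpoch (- (C * h * h)) h m.
  have := qpoch_shift (- (C * h)) h m.
  by rewrite !mulNr !opprK exprS mulrA.
(* At C h the product starts one factor later; the coefficient C h + A of the recurrence supplies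
   the missing one. *)
have shA : (A + C * h) * \prod_(j < n) (A + C * h * h ^+ j.+1)
    = \prod_(j < n) (A + C * h ^+ j.+1) * (A + C * h ^+ n.+1).
  transitivity (\prod_(j < n.+1) (A + C * h ^+ j.+1)); last first.
    by rewrite big_ord_recr.
  rewrite big_ord_recl expr1; congr (_ * _).
  by apply: eq_bigr => j _; rewrite -mulrA -exprS.
have d1 : qpoch (- (C * h)) h n.+1
    = qpoch (- (C * h)) h n * (1 + C * h ^+ n.+1).
  by rewrite qpochS exprS; ring.
have d2 : qpoch (- (C * h)) h n.+1.*2 =
    qpoch (- (C * h)) h n.*2 * (1 + C * h ^+ n.*2.+1) * (1 + C * h ^+ n.*2.+2).
  by rewrite doubleS !qpochS [h ^+ n.*2.+2]exprS [h ^+ n.*2.+1]exprS; ring.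
rewrite mulrDr.
transitivity ((1 + C * q ^+ n * h) * (1 + C * q ^+ n.+1)
    * (q ^+ n.+1 * C ^+ 2 - A ^+ 2) * (1 + C * h ^+ n.+1)
    * (qpoch (- (C * h)) h n * awJ_sum n A C (A * h) A)
  + (1 - C ^+ 2 * q ^+ n.+1 ^+ 2) * (C + A) * (C * h + A)
    * ((qpoch (- (C * h)) h n * (1 + C * h ^+ n.+1))
    * awJ_sum n A (C * h) (A * h) A)).
  by rewrite d1; ring.
rewrite e1 sh -[_ * _ * awJ_sum _ _ _ _ _]mulrA e2.
transitivity ((1 + C * q ^+ n * h) * (1 + C * q ^+ n.+1)
    * (q ^+ n.+1 * C ^+ 2 - A ^+ 2) * (1 + C * h ^+ n.+1)
    * (qpoch (A * h) h n * \prod_(j < n) (A + C * h ^+ j.+1) * qpoch (- h) h n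
       * qpoch (- (C * h)) h n.*2)
  + (1 - C ^+ 2 * q ^+ n.+1 ^+ 2) * (C + A)
    * (qpoch (A * h) h n
       * ((A + C * h) * \prod_(j < n) (A + C * h * h ^+ j.+1))
       * qpoch (- h) h n * ((1 + C * h) * qpoch (- (C * h * h)) h n.*2))).
  by ring.
rewrite shA -sh d2 big_ord_recr /= ![qpoch _ h n.+1]qpochS.
have hE : h ^+ n.*2 = (h ^+ n) ^+ 2 by rewrite -exprM muln2.
rewrite ![h ^+ n.*2.+2]exprS ![h ^+ n.*2.+1]exprS hE.
have -> : q ^+ n.+1 = q * (h ^+ n) ^+ 2 by rewrite exprS /q exprAC.
have -> : q ^+ n = (h ^+ n) ^+ 2 by rewrite /q exprAC.
rewrite ![h ^+ n.+1]exprS.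
rewrite /q; ring.
Qed.

(* u = A q, v = A / h is z = h^(3/2), and u = A h, v = A is z = h^(-1/2): their
   difference is the divided difference centred at h^(1/2). *)
Lemma awJ_sum_shift n A C : qpoch q q n.+1 != 0 ->
  awJ_sum n.+1 A C (A * q) (A / h) = awJ_sum n.+1 A C (A * h) A
    + A * (1 - h^-1) * q * (1 - q ^- n.+1) * (1 - q ^+ n.+2 * C ^+ 2)
      * awJ_sum n (A * h) (C * q) (A * h * h) (A * h).
Proof.
(* The k = 0 terms agree, since u and v enter only through (u, v; q)_k; term j+1 is then matched
   with term j of the lower sum. *)
move=> qn0; rewrite /awJ_sum mulr_sumr big_ord_recl [in RHS]big_ord_recl -addrA.
congr (_ + _); first by rewrite /awJ_term !qpochsE !qpoch0.
rewrite -big_split /=; apply: eq_bigr => -[j /= jn] _.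
have : qpoch q q j.+1 != 0 by exact: qpoch_neq0_le jn qn0.
rewrite /bump /= add1n /awJ_term !qpochsE subSS qpoch_qneg_shift.
rewrite [qpoch (q ^+ n.+2 * C ^+ 2) q j.+1]qpochSl.
rewrite [qpoch (A / h) q j.+1]qpochSl [qpoch (A * q) q j.+1]qpochS.
rewrite [qpoch (A * h) q j.+1]qpochS [qpoch A q j.+1]qpochSl.
have -> : q ^+ n.+1 * (C * q) ^+ 2 = q ^+ n.+2 * C ^+ 2 * q.
  by rewrite [q ^+ n.+2]exprS; ring.
have -> : A / h * q = A * h by rewrite /q; field.
have -> : A * h * h = A * q by rewrite /q; ring.
have -> : (A * h) ^+ 2 * q ^+ j.+1 = A ^+ 2 * q ^+ j.+2.
  by rewrite [q ^+ j.+2]exprS /q; ring.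
have -> : - (C * q * q ^+ j.+1) = - (C * q ^+ j.+2).
  by rewrite [q ^+ j.+2]exprS; ring.
have -> : - (C * q * h * q ^+ j) = - (C * h * q ^+ j.+1).
  by rewrite [q ^+ j.+1]exprS; ring.
rewrite [qpoch q q j.+1]qpochS mulf_eq0 negb_or => /andP[P0].
move: (q ^- n.+1) (q ^+ n.+2) => N M.
rewrite ![q ^+ j.+1]exprS.
move: (q ^+ j) (qpoch q q j) P0 => Q P P0 q0.
move: (qpoch _ q j) (qpoch _ q j) (qpoch _ q j) (qpoch _ q j) => X1 X2 X3 X4.
move: (qpoch _ q _) (qpoch _ q _) (qpoch _ q _) => X5 X6 X7.
rewrite /q; field.
by rewrite q0 h_neq0 P0.
Qed.

(** Both sums on the right of [awJ_sum_shift] have product values; the last bracket is what remains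
    after their common factors are taken out. *)
Lemma awJ_sum_eval n A C : C != 0 -> qpoch q q n.+1 != 0 ->
  qpoch (- (C * h)) h n.+1 * awJ_sum n.+1 A C (A * q) (A / h) =
  qpoch (A * h ^+ 2) h n * \prod_(j < n) (A + C * h ^+ j.+2)
  * qpoch (- h) h n.+1 * qpoch (- (C * h)) h n.+1.*2
  * ((1 - A * h) * (A + C * h)
     - A * (1 - h) * (1 - h ^- n.+1) * (1 - C * h ^+ n.+2)).
Proof.
move=> C0 qn0; rewrite awJ_sum_shift // mulrDr awJ_sum_product //.
have Pn0 := qpoch_neq0_le (leqnSn n) qn0.
have e := awJ_sum_product (A * h) (mulf_neq0 C0 q_neq0) Pn0.
have cE : - (C * h) * h * h = - (C * q * h) by rewrite /q; ring.
(* The factor 1 + C h^(n+2) of 1 - q^(n+2) C^2 extends the product by one; removing its first two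
   factors leaves the one belonging to C q. *)
have d1 : qpoch (- (C * h)) h n.+1 * (1 + C * h ^+ n.+2)
  = (1 + C * h) * (1 + C * h ^+ 2) * qpoch (- (C * q * h)) h n.
  have -> : 1 + C * h ^+ n.+2 = 1 - (- (C * h)) * h ^+ n.+1.
    by rewrite [h ^+ n.+2]exprS; ring.
  by rewrite -qpochS 2!qpochSl cE; ring.
have d2 : qpoch (- (C * h)) h n.+1.*2
  = (1 + C * h) * (1 + C * h ^+ 2) * qpoch (- (C * q * h)) h n.*2.
  by rewrite doubleS 2!qpochSl cE; ring.
(* This [h ^+ n] turns the factor 1 + h^-(n+1) of 1 - q^-(n+1) into h^-1 (1 + h^(n+1)), which
   contains the last factor of (-h; h)_(n+1). *)
have pE : \prod_(j < n) (A * h + C * q * h ^+ j.+1)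
  = h ^+ n * \prod_(j < n) (A + C * h ^+ j.+2).
  rewrite -[n in h ^+ n]card_ord -prodr_const -big_split /=.
  by apply: eq_bigr => j _; rewrite [h ^+ j.+2]exprS /q; ring.
set T := awJ_sum n _ _ _ _ in e *.
transitivity (qpoch (A * h) h n.+1 * \prod_(j < n.+1) (A + C * h ^+ j.+1)
   * qpoch (- h) h n.+1 * qpoch (- (C * h)) h n.+1.*2
  + A * (1 - h^-1) * q * (1 - q ^- n.+1) * (1 - C * h ^+ n.+2)
   * ((qpoch (- (C * h)) h n.+1 * (1 + C * h ^+ n.+2)) * T)).
  congr (_ + _); rewrite (_ : q ^+ n.+2 = (h ^+ n.+2) ^+ 2); first by ring.
  by rewrite /q exprAC.
rewrite d1 -[_ * _ * T]mulrA e pE d2 big_ord_recl /= expr1.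
rewrite [qpoch (A * h) h n.+1]qpochSl -[A * h * h]mulrA -expr2.
rewrite [qpoch (- h) h n.+1]qpochS.
rewrite (_ : q ^+ n.+1 = (h ^+ n.+1) ^+ 2); last by rewrite /q exprAC.
rewrite ![h ^+ n.+2]exprS ![h ^+ n.+1]exprS.
have := expf_neq0 n h_neq0; move: (h ^+ n) => H H0.
rewrite /q; field.
by rewrite h_neq0 H0.
Qed.

End QuarticSum.

(** * Exponent laws for complex powers of q *)

Section ComplexPowers.
Variable R : realType.
Implicit Types z w s t l : R[i].

Lemma cexpD z w : cexp (z + w) = cexp z * cexp w.
Proof.
case: z w => [a b] [c d]; rewrite /cexp /= expRD cosD sinD.
by apply/eqP; rewrite eq_complex /=; apply/andP; split; apply/eqP; ring.
Qed.

Lemma cexp0 : cexp (0 : R[i]) = 1.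
Proof. by rewrite /cexp /= expR0 cos0 sin0 mul1r. Qed.

Lemma qpowD l s t : qpow l (s + t) = qpow l s * qpow l t.
Proof. by rewrite /qpow mulrDl cexpD. Qed.

Lemma qpow0 l : qpow l 0 = 1.
Proof. by rewrite /qpow mul0r cexp0. Qed.

Lemma qpow1 l : qpow l 1 = cexp l.
Proof. by rewrite /qpow mul1r. Qed.

Lemma qpow_neq0 l s : qpow l s != 0.
Proof.
apply/eqP => e; have := qpowD l s (- s).
by rewrite e mul0r subrr qpow0 => /eqP; rewrite oner_eq0.
Qed.

Lemma qpowN l s : qpow l (- s) = (qpow l s)^-1.
Proof.
apply: (mulIf (qpow_neq0 l s)).
by rewrite -qpowD addNr qpow0 mulVf ?qpow_neq0.
Qed.

Lemma qpow_nat l s n : qpow l (s * n%:R) = qpow l s ^+ n.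
Proof.
elim: n => [|n IHn]; first by rewrite mulr0 qpow0.
by rewrite -natr1 mulrDr mulr1 qpowD IHn exprSr.
Qed.

End ComplexPowers.

(** * From the Askey-Wilson sum to the closed quotient *)

Section Evaluation.
Variable F : fieldType.
Implicit Types A B p eps : F.

(** With p = q^(1/4), the sign of z is absorbed into A: ab is even in A, and ac, ad depend only on
    the product A B. *)
Lemma askey_wilson_z_awJ n A B p eps : p != 0 -> A != 0 -> eps ^+ 2 = 1 ->
  A ^+ n * p ^+ n
  * askey_wilson_z n (eps * p ^+ 3) (A * p) (A * p ^+ 3) (- (B * p))
      (- (B * p ^+ 3)) (p ^+ 4)
  = awJ_sum (p ^+ 2) n (eps * A) (A * B) (eps * A * p ^+ 4) (eps * A / p ^+ 2).
Proof.
move=> p0 A0 e1.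
have e0 : eps != 0.
  by apply: contra_eq_neq e1 => ->; rewrite expr0n eq_sym oner_eq0.
have eV : eps^-1 = eps by apply: (mulfI e0); rewrite divff // -expr2.
rewrite /askey_wilson_z -exprMn.
rewrite mulVKf ?expf_neq0 ?mulf_neq0 //.
rewrite /awJ_sum; apply: eq_bigr => -[k /= kn] _; rewrite /awJ_term.
have -> : p ^+ 2 ^+ 2 = p ^+ 4 by rewrite -exprM.
(* Since abcd = q^2 C^2, the integer exponent n - 1, negative for n = 0, becomes n + 1. *)
have -> : (p ^+ 4) ^ (n%:Z - 1)
    * (A * p * (A * p ^+ 3) * - (B * p) * - (B * p ^+ 3))
  = p ^+ 4 ^+ n.+1 * (A * B) ^+ 2.
  rewrite expfzDr ?expf_neq0 // [p ^+ 4 ^+ n.+1]exprSr -exprnP exprN1.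
  by field.
have -> : A * p * (eps * p ^+ 3) = eps * A * p ^+ 4 by ring.
have -> : A * p * (eps * p ^+ 3)^-1 = eps * A / p ^+ 2.
  by rewrite [(eps * _)^-1]invfM eV; field.
rewrite ![p ^+ 4 ^+ k.+1]exprSr.
move: (p ^+ 4 ^+ k) => K.
have -> : A * p * (A * p ^+ 3) * K = (eps * A) ^+ 2 * (K * p ^+ 4).
  by rewrite exprMn e1; ring.
have -> : A * p * - (B * p) * K = - (A * B * p ^+ 2 * K) by ring.
have -> : A * p * - (B * p ^+ 3) * K = - (A * B * (K * p ^+ 4)) by ring.
by [].
Qed.

(** In base h the denominator is (h, -h; h)_n (-A B h; h)_(2n); its last two products cancel against
    those of [awJ_sum_eval]. *)
Lemma awJ_sum_quotient n A B p : p != 0 -> A != 0 -> B != 0 ->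
  let h := p ^+ 2 in let q := p ^+ 4 in
  qpochs [:: q; - (A * B * h); - (A * B * q)] q n != 0 ->
  qpochs [:: h; - (A * B * h)] h n != 0 ->
  1 - A * h != 0 -> 1 + B * h != 0 ->
  awJ_sum h n A (A * B) (A * q) (A / h)
    / qpochs [:: q; - (A * B * h); - (A * B * q)] q n
  = A ^+ n * (qpochs [:: A * h; - (B * h)] h n
              / qpochs [:: h; - (A * B * h)] h n)
    * (1 - ((1 - h) * (1 - h ^- n) * (1 - A * B * h ^+ n.+1))
           / ((1 - A * h) * (1 + B * h))).
Proof.
move=> p0 A0 B0 h q; have h0 : h != 0 by rewrite expf_neq0.
have qE : q = h ^+ 2 by rewrite -exprM.
rewrite !qpochsE qE; move: (h) h0 {p0 qE q} => {p} {}h h0.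
have -> : A * B * h ^+ 2 = A * B * h * h by ring.
rewrite -[- (_ * h * h)]mulNr -qpoch_double qpoch_sqr.
(* [awJ_sum_eval] covers only positive degree; at n = 0 the factor 1 - h^-n vanishes and both sides
   are 1. *)
case: n => [|n].
  move=> _ _ _ _.
  rewrite /awJ_sum big_ord1 /awJ_term !qpochsE !qpoch0 !expr0 !invr1.
  by rewrite subrr !(mulr0, mul0r) subr0 !(mulr1, divr1).
rewrite !mulf_eq0 !negb_or => /andP[/andP[W0 V0] D20] /andP[_ D0] a1 b1.
have := awJ_sum_eval h0 (n := n) A (mulf_neq0 A0 B0).
rewrite qpoch_sqr mulf_neq0 // => /(_ isT).
have -> : \prod_(j < n) (A + A * B * h ^+ j.+2)
    = A ^+ n * qpoch (- (B * h ^+ 2)) h n.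
  rewrite -[n in A ^+ n]card_ord -prodr_const -big_split /=.
  by apply: eq_bigr => j _; rewrite [h ^+ j.+2](exprD h 2 j); ring.
(* The split-off factors match (1 - A h)(A + C h) = A (1 - A h)(1 + B h) in the bracket. *)
have -> : qpoch (A * h) h n.+1 = (1 - A * h) * qpoch (A * h ^+ 2) h n.
  by rewrite qpochSl expr2 mulrA.
have -> : qpoch (- (B * h)) h n.+1 = (1 + B * h) * qpoch (- (B * h ^+ 2)) h n.
  by rewrite qpochSl opprK expr2 mulrA mulNr.
move/(canRL (mulKf D0)) => ->.
rewrite [A ^+ n.+1]exprS ![h ^+ n.+2]exprS ![h ^+ n.+1]exprS.
have := expf_neq0 n h0; move: (h ^+ n) => H H0.
move: (qpoch (- (A * B * h)) h n.+1) (qpoch (- (A * B * h)) h n.+1.*2) D0 D20.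
move: (qpoch h h n.+1) (qpoch (- h) h n.+1) W0 V0 => W V W0 V0 D D2 D0 D20.
move: (qpoch _ h n) (qpoch _ h n) => X Y.
field.
by rewrite W0 V0 D0 D20 h0 H0 a1 b1.
Qed.

End Evaluation.

(* eps is the common sign: 1 for the upper signs, -1 for the lower ones. *)
Theorem corollary2p9 (R : realType) (n : nat) (q logq alpha beta eps : R[i])
  (q_neq0 : q != 0) (normq_neq1 : `|q| != 1) (logqE : cexp logq = q)
  (epsE : eps = 1 \/ eps = -1)
  (lhs_den : qJacobi_den n alpha beta logq != 0)
  (rhs_den : qpochs [:: qpow logq (1 / 2);
                        - qpow logq ((alpha + beta + 1) / 2)]
                    (qpow logq (1 / 2)) n != 0)
  (rhs_den_alpha : 1 - eps * qpow logq ((alpha + 1) / 2) != 0)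
  (rhs_den_beta : 1 + eps * qpow logq ((beta + 1) / 2) != 0) :
  qJacobi n alpha beta
    (eps * (1 / 2 * (qpow logq (3 / 4) + qpow logq (- (3 / 4))))) logq
  = (eps * qpow logq (alpha / 2)) ^+ n
    * (qpochs [:: eps * qpow logq ((alpha + 1) / 2);
                  - eps * qpow logq ((beta + 1) / 2)]
              (qpow logq (1 / 2)) n
       / qpochs [:: qpow logq (1 / 2);
                    - qpow logq ((alpha + beta + 1) / 2)]
                (qpow logq (1 / 2)) n)
    * (1 - ((1 - qpow logq (1 / 2)) * (1 - qpow logq (- (n%:R / 2)))
            * (1 - qpow logq ((alpha + beta + n%:R + 1) / 2)))
           / ((1 - eps * qpow logq ((alpha + 1) / 2))
              * (1 + eps * qpow logq ((beta + 1) / 2)))).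
Proof.
have e1 : eps ^+ 2 = 1 by case: epsE => ->; rewrite ?sqrrN expr1n.
have e0 : eps != 0 by case: epsE => ->; rewrite ?oppr_eq0 oner_eq0.
have eV : eps^-1 = eps by apply: (mulfI e0); rewrite divff // -expr2.
(* Every power of q in the statement is a monomial in these three. *)
pose p := qpow logq (1 / 4); pose A := qpow logq (alpha / 2).
pose B := qpow logq (beta / 2).
have p0 : p != 0 by exact: qpow_neq0.
have A0 : A != 0 by exact: qpow_neq0.
have B0 : B != 0 by exact: qpow_neq0.
have pX k : p ^+ k = qpow logq (k%:R / 4).
  by rewrite /p -qpow_nat; congr qpow; ring.
have qE : cexp logq = p ^+ 4.
  by rewrite pX divff ?pnatr_eq0 // qpow1.
have hE : qpow logq (1 / 2) = p ^+ 2 by rewrite pX; congr qpow; field.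
have ahE : qpow logq ((alpha + 1) / 2) = A * p ^+ 2.
  by rewrite pX /A -qpowD; congr qpow; field.
have bhE : qpow logq ((beta + 1) / 2) = B * p ^+ 2.
  by rewrite pX /B -qpowD; congr qpow; field.
have abhE : qpow logq ((alpha + beta + 1) / 2) = A * B * p ^+ 2.
  by rewrite pX /A /B -!qpowD; congr qpow; field.
have abqE : qpow logq ((alpha + beta + 2) / 2) = A * B * p ^+ 4.
  by rewrite pX /A /B -!qpowD; congr qpow; field.
have aE : qpow logq (alpha / 2 + 1 / 4) = A * p by rewrite qpowD.
have bE : qpow logq (alpha / 2 + 3 / 4) = A * p ^+ 3 by rewrite qpowD pX.
have cE : qpow logq (beta / 2 + 1 / 4) = B * p by rewrite qpowD.
have dE : qpow logq (beta / 2 + 3 / 4) = B * p ^+ 3 by rewrite qpowD pX.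
have nE : qpow logq (- (n%:R / 2)) = (p ^+ 2) ^- n.
  by rewrite -exprM pX qpowN natrM; congr (qpow _ _)^-1; field.
have abnE : qpow logq ((alpha + beta + n%:R + 1) / 2)
    = A * B * (p ^+ 2) ^+ n.+1.
  by rewrite -exprM pX natrM /A /B -!qpowD -natr1; congr qpow; field.
have abE : eps * A * (eps * B) = A * B by rewrite mulrACA -expr2 e1 mul1r.
have AE : qpow logq (alpha / 2) = A by [].
move: lhs_den rhs_den rhs_den_alpha rhs_den_beta.
rewrite /qJacobi qpow_nat /qJacobi_den qE aE bE cE dE ahE bhE abhE abqE nE abnE.
rewrite hE qpowN.
have -> : qpow logq (3 / 4) = p ^+ 3 by rewrite pX.
(* The evaluation point has z = eps q^(3/4), because eps is its own inverse. *)
have -> : eps * (1 / 2 * (p ^+ 3 + (p ^+ 3)^-1))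
  = 2^-1 * (eps * p ^+ 3 + (eps * p ^+ 3)^-1).
  by rewrite [(eps * _)^-1]invfM eV; field.
clearbody p A B.
have z0 : eps * p ^+ 3 != 0 by rewrite mulf_neq0 // expf_neq0.
rewrite askey_wilsonE //.
rewrite [(A * p) ^+ n]exprMn [_ / _ * askey_wilson_z _ _ _ _ _ _ _]mulrAC.
rewrite askey_wilson_z_awJ //.
(* Writing A B as (eps A)(eps B) lets one evaluation at eps A and eps B serve both signs. *)
rewrite AE -abE mulNr ![eps * (_ * _)]mulrA.
exact: awJ_sum_quotient p0 (mulf_neq0 e0 A0) (mulf_neq0 e0 B0).
Qed.
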